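(* Let $X$ be an $n$-dimensional complex manifold, $Y\subset X$ a complex submanifold, $\mathcal M$ a coherent left $\mathcal D_X$-module, $p\in Y$, and $u$ a section of $\mathcal M$ defined on a neighborhood of $p$. Let $x''$ be a local coordinate system of $Y$ around $p$. Assume that an indicial polynomial $b(s,x'')\in(\mathcal O_Y)_p[s]$ of $u$ along $Y$ at $p$ exists. Then: 1. The polynomial $b(s,p)\in\mathbb C[s]$ is uniquely determined (i.e. it does not depend on the choice of the indicial polynomial $b(s,x'')$ of $u$ along $Y$ at $p$). 2. If $f(s,x'')\in(\mathcal O_Y)_p[s]$ belongs to $\mathcal J_Y(u)_p$, then $f(s,p)$ is a multiple of $b(s,p)$ in $\mathbb C[s]$. In particular, $$\{s\in\mathbb C\mid f(s,p)=0\ \ (\forall f(s,x'')\in\mathcal J_Y(u)_p)\}=\{s\in\mathbb C\mid b(s,p)=0\}.$$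
   Context: $\mathcal O_X$ is the sheaf of holomorphic functions on $X$, $\mathcal D_X$ the sheaf of rings of differential operators with holomorphic coefficients, $\mathcal I_Y\subset\mathcal O_X$ the defining ideal of $Y$. The $V$-filtration along $Y$ is $$V_Y^j(\mathcal D_X)=\{P\in\mathcal D_X|_Y\mid P\,\mathcal I_Y^i\subset\mathcal I_Y^{i-j}\ (\forall i\in\mathbb Z)\}\quad(j\in\mathbb Z),$$ with $\mathcal I_Y^i=\mathcal O_X|_Y$ for $i\le 0$. Let $\theta$ be a vector field near $p$ inducing the identity on $\mathcal I_Y/\mathcal I_Y^2$; in local coordinates $(x_1,\dots,x_n)$ with $Y=\{x_1=\dots=x_d=0\}$ one may take $\theta=x_1\partial_{x_1}+\dots+x_d\partial_{x_d}$, and then $x''=(x_{d+1},\dots,x_n)$ are coordinates of $Y$. The ideal $\mathcal J_Y(u)$ of $\mathcal O_Y[s]$ is $$\mathcal J_Y(u)=\{f(s,x'')\in\mathcal O_Y[s]\mid f(\theta,x'')u\in V_Y^{-1}(\mathcal D_X)u\}.$$ An indicial polynomial of $u$ along $Y$ at $p$ is an element $b(s,x'')\in\mathcal J_Y(u)_p\subset(\mathcal O_Y)_p[s]$ which is monic in $s$ and has the smallest degree in $s$ among the elements of $\mathcal J_Y(u)_p$ that are monic in $s$. For $f(s,x'')\in(\mathcal O_Y)_p[s]$, $f(s,p)\in\mathbb C[s]$ is obtained by evaluating the coefficients at $p$.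
   Formalization: If Y has codimension 0 at p, where inducing the identity on I_Y/I_Y^2 is an empty condition and the claim fails for general θ (e.g. X=Y=ℂ, θ=d/dx, (θ−x)u=0), the vector field θ is required to be 0, as the coordinate formula gives. *)

(* Defs.v *)
From HB Require Import structures.
From mathcomp Require Import all_boot all_order all_algebra.
From mathcomp Require Import ring_quotient.
From mathcomp Require Import complex.
From mathcomp Require Import all_classical all_reals all_analysis.

Set Implicit Arguments.
Unset Strict Implicit.
Unset Printing Implicit Defensive.

Import Order.TTheory GRing.Theory Num.Theory.
Import numFieldNormedType.Exports.

Local Open Scope classical_set_scope.
Local Open Scope ring_scope.
Local Open Scope quotient_scope.

(* The wrapper around R[i] gives access to the topology and the norm that
   MathComp-Analysis puts on every numClosedFieldType. *)
Definition Cplx (R : realType) : numClosedFieldType := R[i].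

(* [cmap] and [cinv] are total functions; only the values of [cmap] on [cdom]
   and of [cinv] on the image of [cdom] are meaningful. *)
Record chart (R : realType) (X : topologicalType) (n : nat) := Chart {
  cdom : set X;
  cmap : X -> 'rV[Cplx R]_n;
  cinv : 'rV[Cplx R]_n -> X }.

Definition is_chart (R : realType) (X : topologicalType) n (c : chart R X n) :=
  [/\ open (cdom c), open (cmap c @` cdom c),
      forall q, cdom c q -> cinv c (cmap c q) = q,
      forall q, cdom c q -> {for q, continuous (cmap c)} &
      forall q, cdom c q -> {for cmap c q, continuous (cinv c)}].

Definition holo_transition (R : realType) (X : topologicalType) n
    (c c' : chart R X n) :=
  forall q, cdom c q -> cdom c' q ->
    differentiable (cmap c' \o cinv c) (cmap c q).

Record cmanifold (R : realType) (n : nat) := CManifold {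
  mspace :> topologicalType;
  atlas : set (chart R mspace n);
  mspace_hausdorff : hausdorff_space mspace;
  mspace_countable : @second_countable mspace;
  atlas_chart : forall c, atlas c -> is_chart c;
  atlas_cover : forall q : mspace, exists2 c, atlas c & cdom c q;
  atlas_compat : forall c c', atlas c -> atlas c' -> holo_transition c c' }.

(* The charts of the maximal atlas. *)
Definition holo_chart (R : realType) n (X : cmanifold R n)
    (c : chart R X n) :=
  is_chart c /\
  forall c', atlas c' -> holo_transition c c' /\ holo_transition c' c.

(* A chart whose domain contains p, in which Y is given by
   x_0 = ... = x_(d-1) = 0; the remaining n - d coordinates are the
   coordinates x'' of Y. *)
Definition adapted_chart (R : realType) n (X : cmanifold R n) (Y : set X)
    (d : nat) (c : chart R X n) (p : X) :=
  [/\ holo_chart c, cdom c p, (d <= n)%N &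
      forall q, cdom c q ->
        (Y q <-> forall i : 'I_n, (i < d)%N -> cmap c q ord0 i = 0)].

Definition submanifold (R : realType) n (X : cmanifold R n) (Y : set X) :=
  forall p, Y p -> exists d c, adapted_chart Y d c p.

Section Germs.
Variables (R : realType) (n : nat) (X : cmanifold R n).
Local Notation C := (Cplx R).

Definition holo_at (f : X -> C) (q : X) :=
  forall c : chart R X n, atlas c -> cdom c q ->
    differentiable (f \o cinv c) (cmap c q).

Definition holo_on (U : set X) (f : X -> C) := forall q, U q -> holo_at f q.

Definition holo_near (x : X) : {pred X -> C} :=
  fun f => `[< \forall q \near x, holo_at f q >].

Fact holo_near_subring x : subring_closed (holo_near x).
Proof.
split=> [|f g /asboolP hf /asboolP hg|f g /asboolP hf /asboolP hg];
  apply/asboolP.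
- near=> q => c _ _; exact: (differentiable_cst (1 : C)).
- near=> q => c ac dc.
  have Hf : holo_at f q by near: q.
  have Hg : holo_at g q by near: q.
  exact: (differentiableB (Hf c ac dc) (Hg c ac dc)).
- near=> q => c ac dc.
  have Hf : holo_at f q by near: q.
  have Hg : holo_at g q by near: q.
  exact: (differentiableM (Hf c ac dc) (Hg c ac dc)).
Unshelve. all: by end_near. Qed.

HB.instance Definition _ x := GRing.isSubringClosed.Build (X -> C)
  (holo_near x) (holo_near_subring x).

(* Functions on X that are holomorphic on a neighborhood of x. *)
Record holofun (x : X) := HoloFun {
  holofun_val :> X -> C;
  _ : holofun_val \in holo_near x }.

HB.instance Definition _ x := [isSub for @holofun_val x].
HB.instance Definition _ x := [Choice of holofun x by <:].
HB.instance Definition _ x := GRing.SubChoice_isSubComPzRing.Build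
  (X -> C) (holo_near x) (holofun x) (holo_near_subring x).

Fact holofun_oner_neq0 x : (1 : holofun x) != 0.
Proof.
apply/eqP => /(congr1 (fun f : holofun x => f x)) /eqP.
by rewrite [X in X == _](_ : _ = 1) // oner_eq0.
Qed.
HB.instance Definition _ x :=
  GRing.PzSemiRing_isNonZero.Build (holofun x) (holofun_oner_neq0 x).

(* The functions vanishing on S near x.  In every use x is a point of S; the
   clause [q = x] only serves to make the ideal proper for every S and x. *)
Definition vanishing (S : set X) (x : X) : {pred holofun x} :=
  fun f => `[< \forall q \near x, S q \/ q = x -> f q = 0 >].
Arguments vanishing : clear implicits.

Fact vanishing_idealr S x : idealr_closed (vanishing S x).
Proof.
split.
- by apply/asboolP; near=> q.
- apply/asboolP => /nbhs_singleton /(_ (or_intror erefl)) /eqP.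
  by rewrite [X in X == _](_ : _ = 1) // oner_eq0.
- move=> a f g /asboolP hf /asboolP hg; apply/asboolP.
  apply: filterS2 hf hg => q hf hg Sq.
  rewrite [LHS](_ : _ = a q * f q + g q) //.
  by rewrite hf // hg // mulr0 addr0.
Unshelve. all: by end_near. Qed.

HB.instance Definition _ S x := isIdealr.Build (holofun x) (vanishing S x)
  (vanishing_idealr S x).

(* Germs at x of functions on S that are locally restrictions of holomorphic
   functions on X: for S = X this is the stalk of O_X at x, and for x in a
   submanifold S = Y it is the stalk of O_Y = O_X / I_Y at x. *)
Definition germ_on (S : set X) (x : X) := {ideal_quot (vanishing S x)}.
HB.instance Definition _ S x := GRing.ComNzRing.on (germ_on S x).

Definition Ogerm (x : X) := germ_on setT x.
HB.instance Definition _ x := GRing.ComNzRing.on (Ogerm x).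

(* The germ at x of f; a junk value unless f is holomorphic near x. *)
Definition to_germ (x : X) (f : X -> C) : Ogerm x :=
  \pi_(Ogerm x) (insubd (0 : holofun x) f).

Definition restr_germ (S : set X) (x : X) (g : Ogerm x) : germ_on S x :=
  \pi_(germ_on S x) (repr g).

Definition eval_germ (S : set X) (x : X) (g : germ_on S x) : C := repr g x.

(* C-linear derivations of the stalk of O_X, i.e. germs of holomorphic vector
   fields. *)
Definition derivation (x : X) (v : Ogerm x -> Ogerm x) :=
  [/\ forall f g, v (f + g) = v f + v g,
      forall f g, v (f * g) = v f * g + f * v g &
      forall a : C, v (to_germ x (cst a)) = 0].

(* The stalk of D_X at x is the subring of the ring of C-linear endomorphisms
   of the stalk of O_X generated by the multiplications by germs of functions
   and by the germs of vector fields. *)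
Inductive is_diffop (x : X) : (Ogerm x -> Ogerm x) -> Prop :=
| diffop_fun a : is_diffop ( *%R a)
| diffop_field v : derivation v -> is_diffop v
| diffop_add P Q : is_diffop P -> is_diffop Q -> is_diffop (P + Q)
| diffop_opp P : is_diffop P -> is_diffop (- P)
| diffop_comp P Q : is_diffop P -> is_diffop Q -> is_diffop (P \o Q).

Definition diffop_pred (x : X) : {pred Ogerm x -> Ogerm x} :=
  fun P => `[< is_diffop P >].
Arguments diffop_pred : clear implicits.

Record Dgerm (x : X) := DGerm {
  dop :> Ogerm x -> Ogerm x;
  dopP : dop \in diffop_pred x }.

HB.instance Definition _ x := [isSub for @dop x].
HB.instance Definition _ x := [Choice of Dgerm x by <:].

Fact diffop_zmod x : zmod_closed (diffop_pred x).
Proof.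
split=> [|P Q /asboolP hP /asboolP hQ]; apply/asboolP.
- suff -> : 0 = *%R (0 : Ogerm x) :> (Ogerm x -> Ogerm x).
    exact: diffop_fun.
  by apply/funext => f; rewrite mul0r.
- exact: diffop_add hP (diffop_opp hQ).
Qed.
HB.instance Definition _ x := GRing.isZmodClosed.Build (Ogerm x -> Ogerm x)
  (diffop_pred x) (diffop_zmod x).
HB.instance Definition _ x := [SubChoice_isSubZmodule of Dgerm x by <:].

Fact dop_additive x (P : Dgerm x) f g : P (f + g) = P f + P g.
Proof.
case: P => P /= /asboolP hP; elim: hP f g => {P}.
- by move=> a f g; rewrite mulrDr.
- by move=> v [vD _ _].
- move=> P Q _ hP _ hQ f g.
  rewrite [LHS](_ : _ = P (f + g) + Q (f + g)) // hP hQ.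
  by rewrite addrACA.
- move=> P _ hP f g.
  by rewrite [LHS](_ : _ = - P (f + g)) // hP opprD.
- by move=> P Q _ hP _ hQ f g /=; rewrite hQ hP.
Qed.

Fact dmul_subproof x (P Q : Dgerm x) : dop P \o dop Q \in diffop_pred x.
Proof.
by apply/asboolP; apply: diffop_comp; apply/asboolP; exact: dopP.
Qed.
Definition dmul x (P Q : Dgerm x) : Dgerm x := DGerm (dmul_subproof P Q).

Fact dfun_subproof x (a : Ogerm x) : *%R a \in diffop_pred x.
Proof. by apply/asboolP; exact: diffop_fun. Qed.

(* O_X as a subring of D_X. *)
Definition dfun x (a : Ogerm x) : Dgerm x := DGerm (dfun_subproof a).

Fact dmulA x : associative (@dmul x).
Proof. by move=> P Q T; apply/val_inj. Qed.
Fact dmul1l x : left_id (dfun (1 : Ogerm x)) (@dmul x).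
Proof. by move=> P; apply/val_inj/funext => f /=; rewrite mul1r. Qed.
Fact dmul1r x : right_id (dfun (1 : Ogerm x)) (@dmul x).
Proof. by move=> P; apply/val_inj/funext => f /=; rewrite mul1r. Qed.
Fact dmulDl x : left_distributive (@dmul x) +%R.
Proof. by move=> P Q T; apply/val_inj/funext. Qed.
Fact dmulDr x : right_distributive (@dmul x) +%R.
Proof.
by move=> P Q T; apply/val_inj/funext => f; rewrite /= dop_additive.
Qed.
Fact done_neq0 x : dfun (1 : Ogerm x) != 0.
Proof.
apply/eqP => /(congr1 (fun P : Dgerm x => P 1)) /eqP.
by rewrite /= mulr1 [X in _ == X](_ : _ = 0) // oner_eq0.
Qed.
HB.instance Definition _ x := GRing.Zmodule_isNzRing.Build (Dgerm x)
  (@dmulA x) (@dmul1l x) (@dmul1r x) (@dmulDl x) (@dmulDr x) (@done_neq0 x).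

(* A section of D_X over U is an endomorphism of the sheaf O_X on U whose germs
   are differential operators.  It is presented here by its germs; by the
   identity theorem, a germ [P x] determines [P y] for y near x, so that P is
   locally a single differential operator. *)
Definition Dsection (U : set X) (P : forall x, Dgerm x) :=
  forall (W : set X) f, open W -> W `<=` U -> holo_on W f ->
    exists2 g, holo_on W g &
      forall x, W x -> P x (to_germ x f) = to_germ x g.

End Germs.

(* A sheaf of left D_X-modules, presented by its espace etale: the stalks,
   together with the families of germs [s] that are sections over the open
   set [U].  The values of [s] outside [U] are irrelevant. *)
Record Dmodule (R : realType) n (X : cmanifold R n) := DModule {
  stalk :> forall x : X, lmodType (Dgerm x);
  msection : set X -> (forall x, stalk x) -> Prop;
  msection_ext : forall (U : set X) s t, (forall x, U x -> s x = t x) ->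
    msection U s -> msection U t;
  msection_restr : forall (U V : set X) s, open U -> open V -> V `<=` U ->
    msection U s -> msection V s;
  msection_glue : forall (U : set X) s, open U ->
    (forall x, U x -> exists V, [/\ open V, V x & msection V s]) ->
    msection U s;
  msection_germ : forall x (m : stalk x), exists (U : set X) s,
    [/\ open U, U x, msection U s & s x = m];
  msection_eq : forall (U : set X) s t x, open U -> U x ->
    msection U s -> msection U t -> s x = t x ->
    exists V : set X, [/\ open V, V x & forall y, V y -> s y = t y];
  msection_add : forall (U : set X) s t, open U ->
    msection U s -> msection U t -> msection U (fun x => s x + t x);
  msection_act : forall (U : set X) P s, open U ->
    Dsection U P -> msection U s -> msection U (fun x => P x *: s x) }.

Section DModules.
Variables (R : realType) (n : nat) (X : cmanifold R n).
Implicit Types M : Dmodule X.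

Definition finite_type M := forall x : X,
  exists (U : set X) k (s : 'I_k -> forall y, M y),
    [/\ open U, U x, forall i, msection U (s i) &
        forall y, U y -> forall m : M y,
          exists P : 'I_k -> Dgerm y, m = \sum_i P i *: s i y].

(* For all sections s_1, ..., s_k over an open set U, the sheaf of relations
   between them is of finite type. *)
Definition finite_relations M :=
  forall (U : set X) k (s : 'I_k -> forall y, M y), open U ->
    (forall i, msection U (s i)) -> forall x, U x ->
  exists (V : set X) r (Q : 'I_r -> 'I_k -> forall y, Dgerm y),
    [/\ open V, V x, V `<=` U, forall j i, Dsection V (Q j i) &
        forall y, V y ->
          (forall j, \sum_i Q j i y *: s i y = 0) /\
          (forall P : 'I_k -> Dgerm y, \sum_i P i *: s i y = 0 ->
             exists a : 'I_r -> Dgerm y,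
               forall i, P i = \sum_j a j * Q j i y)].

Definition coherent M := finite_type M /\ finite_relations M.

End DModules.

Section Indicial.
Variables (R : realType) (n : nat) (X : cmanifold R n) (Y : set X) (p : X).
Local Notation C := (Cplx R).

Definition ideal_germ : set (Ogerm p) := [set g | restr_germ Y g = 0].

Fixpoint ideal_germ_pow (k : nat) : set (Ogerm p) :=
  if k is k'.+1 then
    [set g | exists m (a b : 'I_m -> Ogerm p),
       (forall i, ideal_germ (a i) /\ ideal_germ_pow k' (b i)) /\
       g = \sum_i a i * b i]
  else setT.

Definition ideal_germ_zpow (i : int) : set (Ogerm p) :=
  if i is Posz k then ideal_germ_pow k else setT.

Definition Vfiltration (j : int) : set (Dgerm p) :=
  [set P | forall (i : int) g,
     ideal_germ_zpow i g -> ideal_germ_zpow (i - j) (P g)].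

(* Germs of vector fields inducing the identity on I_Y / I_Y^2.  The last
   clause concerns only codimension d = 0: there I_Y = 0 and the condition on
   I_Y / I_Y^2 is empty, whereas x_1 d/dx_1 + ... + x_d d/dx_d is 0. *)
Definition euler_field (d : nat) (theta : Dgerm p) :=
  [/\ derivation theta,
      forall g, ideal_germ g -> ideal_germ_pow 2 (theta g - g) &
      d = 0%N -> theta = 0].

Variables (d : nat) (c : chart R X n).

(* In the coordinates (x', x'') of an adapted chart, sends (x', x'') to
   (0, x''). *)
Definition chart_proj (q : X) : X :=
  cinv c (\row_(i < n) if (i < d)%N then 0 else cmap c q ord0 i).

(* A germ g(x'') of function on Y, regarded as a germ of function on X that
   does not depend on x'. *)
Definition extend_germ (g : germ_on Y p) : Ogerm p :=
  to_germ p (repr g \o chart_proj).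

(* f(theta, x''), with the coefficients to the left of the powers of theta. *)
Definition subst_field (theta : Dgerm p) (f : {poly germ_on Y p}) : Dgerm p :=
  \sum_(k < size f) dfun (extend_germ f`_k) * theta ^+ k.

(* The stalk at p of J_Y(u). *)
Definition indicial_ideal (theta : Dgerm p) (M : Dmodule X)
    (u : forall x, M x) : set {poly germ_on Y p} :=
  [set f | exists2 P, Vfiltration (-1) P &
     subst_field theta f *: u p = P *: u p].

Definition indicial_polynomial (theta : Dgerm p) (M : Dmodule X)
    (u : forall x, M x) (b : {poly germ_on Y p}) :=
  [/\ indicial_ideal theta u b, b \is monic &
      forall f, indicial_ideal theta u f -> f \is monic ->
        (size b <= size f)%N].

End Indicial.

(* f(s, p) *)
Definition poly_at (R : realType) n (X : cmanifold R n) (Y : set X) (p : X)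
    (f : {poly germ_on Y p}) : {poly Cplx R} :=
  map_poly (@eval_germ R n X Y p) f.

(* Main.v *)
(* Idea.  Let A be the stalk of O_Y at p, a local ring with residue field C,
   and J the stalk of J_Y(u), which is an ideal of A[s].  If f in J is not a
   multiple of b at p, neither is its remainder r modulo b; multiplying r by a
   power of s and reducing modulo b again yields an element of J of degree at
   most deg b - 1 whose coefficient of degree deg b - 1 does not vanish at p.
   This coefficient is a unit of A, so J contains a monic polynomial of degree
   deg b - 1, contradicting the minimality of b.
   That J is an ideal is seen modulo V^-1: f(theta) only depends there on the
   coefficients of f up to I_Y, and theta commutes with functions up to I_Y,
   since theta maps O_X into I_Y. *)
From HB Require Import structures.
Require Import Defs.
From mathcomp Require Import all_boot all_order all_algebra.
From mathcomp Require Import ring_quotient.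
From mathcomp Require Import all_classical all_reals all_analysis.

Set Implicit Arguments.
Unset Strict Implicit.
Unset Printing Implicit Defensive.

Import Order.TTheory GRing.Theory Num.Theory.
Import numFieldNormedType.Exports.

Local Open Scope classical_set_scope.
Local Open Scope ring_scope.
Local Open Scope quotient_scope.

(** * Ideals of polynomials over a local ring *)

(** The first hypothesis makes [A] local with maximal ideal the kernel of [ev]. In the application
    [A] is the stalk of O_Y at p and [ev] is evaluation at p. *)
Lemma dvdp_map_minimal_monic (A : comNzRingType) (K : fieldType)
    (ev : {rmorphism A -> K}) (J : {poly A} -> Prop) (b : {poly A}) :
  (forall a, ev a != 0 -> exists a', a' * a = 1) ->
  (forall f g, J f -> J g -> J (f + g)) ->
  (forall q f, J f -> J (q * f)) ->
  J b -> b \is monic ->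
  (forall f, J f -> f \is monic -> (size b <= size f)%N) ->
  forall f, J f -> map_poly ev b %| map_poly ev f.
Proof.
move=> evU JD JM Jb bm bmin f Jf.
(* Since [b] is monic, Euclidean division by [b] is available over [A]. *)
have Jmod g : J g -> J (Pdiv.Ring.rmodp g b).
  move=> Jg; have -> : Pdiv.Ring.rmodp g b = g + (- Pdiv.Ring.rdivp g b) * b.
    by rewrite {2}(Pdiv.RingMonic.rdivp_eq bm g) mulNr addrAC subrr add0r.
  by apply: JD => //; apply: JM.
have ltmod g : (size (Pdiv.Ring.rmodp g b) < size b)%N.
  by rewrite Pdiv.Ring.ltn_rmodp monic_neq0.
have szb : size (map_poly ev b) = size b.
  by rewrite size_map_poly_id0 // (eqP bm) rmorph1 oner_neq0.
rewrite (Pdiv.RingMonic.rdivp_eq bm f) rmorphD rmorphM /=.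
rewrite dvdp_addr ?dvdp_mulIr //.
set r := Pdiv.Ring.rmodp f b.
have [-> | r0] := eqVneq (map_poly ev r) 0; first exact: dvdp0.
exfalso.
have szr : (size (map_poly ev r) < size b)%N.
  exact: leq_ltn_trans (size_poly _ _) (ltmod f).
have szr0 : (0 < size (map_poly ev r))%N by rewrite size_poly_gt0.
case Em : (size b) szr => [//|m] szr.
(* With m = deg b, this power of X moves the leading term of the image of [r] to degree m - 1. *)
pose h := 'X^(m - size (map_poly ev r)) * r.
have mh : map_poly ev h = 'X^(m - size (map_poly ev r)) * map_poly ev r.
  by rewrite rmorphM /= map_polyXn.
have szh : size (map_poly ev h) = m.
  by rewrite mh mulrC size_mulXn // subnK.
(* Coefficients of [h] killed by [ev] may sit in degree m or higher. Reducing modulo [b] removes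
   them without changing the image, which already has smaller degree than the image of [b]. *)
pose h' := Pdiv.Ring.rmodp h b.
have mh' : map_poly ev h' = map_poly ev h.
  have lt' : (size (map_poly ev h') < size (map_poly ev b))%N.
    by rewrite szb; apply: leq_ltn_trans (size_poly _ _) (ltmod h).
  rewrite -[RHS](@modp_small _ _ (map_poly ev b)) ?szb ?szh ?Em //.
  rewrite (Pdiv.RingMonic.rdivp_eq bm h) rmorphD rmorphM /= modpD.
  by rewrite modp_mull add0r modp_small.
have m0 : (0 < m)%N by apply: leq_trans szr0 _.
(* The coefficient of degree m - 1 of [h'] maps to the leading coefficient of the image of [h], so
   it is a unit. *)
have [|a' a'h] := evU h'`_m.-1.
  rewrite -coef_map mh' -szh -[_`__]/(lead_coef _) lead_coef_eq0.
  by rewrite -size_poly_eq0 szh -lt0n.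
have szh' : (size (a'%:P * h')%R <= m)%N.
  rewrite mul_polyC (leq_trans (size_scale_leq _ _)) // -ltnS -Em; exact: ltmod.
have szE : size (a'%:P * h')%R = m.
  apply/eqP; rewrite eqn_leq szh' /= -{1}(prednK m0) ltnNge.
  apply/negP => /leq_sizeP /(_ _ (leqnn _)) /eqP.
  by rewrite coefCM a'h oner_eq0.
have := bmin (a'%:P * h'); rewrite szE Em ltnn => H.
suff: false by [].
apply: H; first by apply: (JM); apply: (Jmod); apply: (JM); exact: Jmod.
by rewrite monicE lead_coefE szE coefCM a'h.
Qed.

(** * Differentials and holomorphy in charts *)

(** The first-order expansion of [f] at [x] is also one of [g], and differentials are unique.
    Representatives of germs agree only locally, so their differentials are compared this way. *)
Lemma near_eq_diff (K : numFieldType) (V W : normedModType K) (f g : V -> W)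
    (x : V) : (\near x, f x = g x) -> differentiable f x ->
  differentiable g x /\ 'd g x = 'd f x :> (V -> W).
Proof.
move=> fg /diff_locallyP [df_cont fE].
have gE : g \o shift x = cst (g x) + 'd f x +o_ 0 id.
  apply/eqaddoP => _/posnumP[e].
  move/eqaddoP: fE => /(_ e%:num (gt0 e)) fE.
  have fg0 : \forall h \near 0, f (h + x) = g (h + x).
    by move: fg; rewrite (near_shift 0) /= subr0.
  have fgx := nbhs_singleton fg.
  by apply: filterS2 fg0 fE => h /= fgh; rewrite !fctE /= fgh fgx.
have dgE := diff_unique df_cont gE.
split; last exact: dgE.
by apply/diff_locallyP; rewrite dgE; split.
Qed.

Section Charts.
Variables (R : realType) (n : nat) (X : cmanifold R n).
Local Notation C := (Cplx R).

Lemma near_chart_inv (c : chart R X n) q : is_chart c -> cdom c q ->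
  \forall z \near cmap c q, cdom c (cinv c z) /\ cmap c (cinv c z) = z.
Proof.
move=> [_ oI cK _ _] cq; have : nbhs (cmap c q) (cmap c @` cdom c).
  by apply: open_nbhs_nbhs; split => //; exists q.
by apply: filterS => _ [r cr <-]; rewrite cK.
Qed.

Lemma near_chart_pull (c : chart R X n) q (P : set X) : is_chart c ->
  cdom c q -> (\forall r \near q, P r) ->
  \forall z \near cmap c q, P (cinv c z).
Proof.
move=> [_ _ cK _ icont] cq Pq; apply: (icont q cq).
by rewrite cK.
Qed.

Lemma near_cdom (c : chart R X n) q : is_chart c -> cdom c q ->
  \forall r \near q, cdom c r.
Proof. by move=> [oc _ _ _ _] cq; apply: open_nbhs_nbhs. Qed.

(** Near the point, [f \o cinv c] is [f \o cinv c'] composed with the transition map. *)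
Lemma differentiable_change_chart (c c' : chart R X n) (f : X -> C) q :
  is_chart c -> is_chart c' -> cdom c q -> cdom c' q ->
  holo_transition c c' -> differentiable (f \o cinv c') (cmap c' q) ->
  differentiable (f \o cinv c) (cmap c q).
Proof.
move=> hc hc' cq c'q cc' df.
have cK : cinv c (cmap c q) = q by case: hc => _ _ + _ _; apply.
have dcomp : differentiable ((f \o cinv c') \o (cmap c' \o cinv c)) (cmap c q).
  apply: differentiable_comp; first exact: cc'.
  by rewrite /= cK.
apply: (proj1 (near_eq_diff _ dcomp)).
apply: filterS (near_chart_pull hc cq (near_cdom hc' c'q)) => z c'z /=.
by case: hc' => _ _ -> //.
Qed.

(** Holomorphy is defined by all atlas charts around [q]; compatibility in both directions lets a
    single chart of the maximal atlas, such as an adapted one, decide it. *)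
Lemma holo_atP (c : chart R X n) (f : X -> C) q : holo_chart c -> cdom c q ->
  holo_at f q <-> differentiable (f \o cinv c) (cmap c q).
Proof.
move=> [hc ct] cq; split=> [hf|df c' ac' c'q].
  have [c' ac' c'q] := atlas_cover q.
  exact: (differentiable_change_chart hc (atlas_chart ac') cq c'q
    (ct c' ac').1 (hf c' ac' c'q)).
exact: (differentiable_change_chart (atlas_chart ac') hc c'q cq
  (ct c' ac').2 df).
Qed.

End Charts.

(** * Germs: representatives, restriction to S, evaluation, units *)

Section GermQuotient.
Variables (R : realType) (n : nat) (X : cmanifold R n).
Local Notation C := (Cplx R).
Implicit Types (S : set X) (x : X).

(** Identities between germs are checked on representatives through this criterion. The case [q = x]
    makes the value at [x] independent of the representative. *)
Lemma germ_eqP S x (f g : holofun x) :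
  \pi_(germ_on S x) f = \pi_(germ_on S x) g <->
  \forall q \near x, S q \/ q = x -> f q = g q.
Proof.
have piE : (\pi_(germ_on S x) f = \pi_(germ_on S x) g) <->
    (f - g \in @vanishing R n X S x).
  by rewrite Quotient.idealrBE; split=> /eqP.
rewrite piE; split=> [/asboolP|] h.
  by apply: filterS h => q h Sq; apply/eqP; rewrite -subr_eq0; apply/eqP/h.
apply/asboolP; apply: filterS h => q h Sq.
by rewrite [LHS](_ : _ = f q - g q) // h // subrr.
Qed.

Lemma repr_germ_near S x (f : holofun x) :
  \forall q \near x, S q \/ q = x -> repr (\pi_(germ_on S x) f) q = f q.
Proof. by apply/germ_eqP; rewrite reprK. Qed.

Lemma germ_on_reprP S x (a b : germ_on S x) :
  a = b <-> \forall q \near x, S q \/ q = x -> repr a q = repr b q.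
Proof. by rewrite -germ_eqP !reprK. Qed.

(** [repr] picks an arbitrary representative, so it respects ring operations only near [x] on [S];
    likewise for the operations that follow. *)
Lemma repr_germD S x (a b : germ_on S x) :
  \forall q \near x, S q \/ q = x -> repr (a + b) q = repr a q + repr b q.
Proof.
have := repr_germ_near S (repr a + repr b : holofun x).
have -> : \pi_(germ_on S x) (repr a + repr b) = a + b.
  rewrite -[in RHS](reprK a) -[in RHS](reprK b).
  exact: (rmorphD (\pi_({ideal_quot (@vanishing R n X S x)}))).
by [].
Qed.

Lemma repr_germN S x (a : germ_on S x) :
  \forall q \near x, S q \/ q = x -> repr (- a) q = - repr a q.
Proof.
have := repr_germ_near S (- repr a : holofun x).
have -> : \pi_(germ_on S x) (- repr a) = - a.
  rewrite -[in RHS](reprK a).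
  exact: (rmorphN (\pi_({ideal_quot (@vanishing R n X S x)}))).
by [].
Qed.

Lemma repr_germM S x (a b : germ_on S x) :
  \forall q \near x, S q \/ q = x -> repr (a * b) q = repr a q * repr b q.
Proof.
have := repr_germ_near S (repr a * repr b : holofun x).
have -> : \pi_(germ_on S x) (repr a * repr b) = a * b.
  rewrite -[in RHS](reprK a) -[in RHS](reprK b).
  exact: (rmorphM (\pi_({ideal_quot (@vanishing R n X S x)}))).
by [].
Qed.

Lemma repr_germ1 S x :
  \forall q \near x, S q \/ q = x -> repr (1 : germ_on S x) q = 1.
Proof.
have := repr_germ_near S (1 : holofun x).
have -> : \pi_(germ_on S x) (1 : holofun x) = 1.
  exact: (rmorph1 (\pi_({ideal_quot (@vanishing R n X S x)}))).
by [].
Qed.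

Lemma restr_germ_near S x (g : Ogerm x) :
  \forall q \near x, S q \/ q = x -> repr (restr_germ S g) q = repr g q.
Proof. exact: repr_germ_near. Qed.

Lemma restr_germ_eqP S x (g : Ogerm x) (a : germ_on S x) :
  restr_germ S g = a <->
  \forall q \near x, S q \/ q = x -> repr g q = repr a q.
Proof. by rewrite -germ_eqP reprK. Qed.

Fact restr_germ_is_zmod_morphism S x : zmod_morphism (@restr_germ R n X S x).
Proof.
move=> a b; apply/restr_germ_eqP.
have hab := repr_germD (a : germ_on setT x) (- b).
have hb := repr_germN (b : germ_on setT x).
have hrab := repr_germD (restr_germ S a) (- restr_germ S b).
have hrb := repr_germN (restr_germ S b).
have hra := restr_germ_near S a; have hrb' := restr_germ_near S b.
near=> q => Sq; have Tq : setT q \/ q = x by left.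
have -> : repr (a - b) q = repr a q - repr b q.
  rewrite (near hab q) // (near hb q) //.
rewrite (near hrab q) // (near hrb q) // (near hra q) // (near hrb' q) //.
Unshelve. all: by end_near. Qed.

Fact restr_germ_is_monoid_morphism S x :
  monoid_morphism (@restr_germ R n X S x).
Proof.
split=> [|a b]; apply/restr_germ_eqP.
  have h1 := repr_germ1 (setT : set X) x; have h := repr_germ1 S x.
  by near=> q => Sq; rewrite (near h1 q) ?(near h q) //; left.
have hab := repr_germM (a : germ_on setT x) b.
have hrab := repr_germM (restr_germ S a) (restr_germ S b).
have hra := restr_germ_near S a; have hrb := restr_germ_near S b.
near=> q => Sq; have Tq : setT q \/ q = x by left.
rewrite (near hab q) // (near hrab q) // (near hra q) // (near hrb q) //.
Unshelve. all: by end_near. Qed.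

HB.instance Definition _ S x := GRing.isZmodMorphism.Build (Ogerm x)
  (germ_on S x) (@restr_germ R n X S x) (@restr_germ_is_zmod_morphism S x).
HB.instance Definition _ S x := GRing.isMonoidMorphism.Build (Ogerm x)
  (germ_on S x) (@restr_germ R n X S x) (@restr_germ_is_monoid_morphism S x).

Fact eval_germ_is_zmod_morphism S x : zmod_morphism (@eval_germ R n X S x).
Proof.
move=> a b; rewrite /eval_germ.
have /nbhs_singleton -> := repr_germD a (- b); last by right.
by have /nbhs_singleton -> := repr_germN b; last by right.
Qed.

Fact eval_germ_is_monoid_morphism S x : monoid_morphism (@eval_germ R n X S x).
Proof.
split=> [|a b]; rewrite /eval_germ.
  by have /nbhs_singleton -> := repr_germ1 S x; last by right.
by have /nbhs_singleton -> := repr_germM a b; last by right.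
Qed.

HB.instance Definition _ S x := GRing.isZmodMorphism.Build (germ_on S x)
  C (@eval_germ R n X S x) (@eval_germ_is_zmod_morphism S x).
HB.instance Definition _ S x := GRing.isMonoidMorphism.Build (germ_on S x)
  C (@eval_germ R n X S x) (@eval_germ_is_monoid_morphism S x).

Lemma holofun_near x (f : holofun x) : \forall q \near x, holo_at f q.
Proof. by apply/asboolP; case: f. Qed.

Lemma holofun_continuous x (f : holofun x) : {for x, continuous f}.
Proof.
have [c ac cx] := atlas_cover x.
have hc := atlas_chart ac.
have [_ _ cK ccont _] := hc.
have df := nbhs_singleton (holofun_near f) c ac cx.
have fE : \forall q \near x, f q = ((f \o cinv c) \o cmap c) q.
  by apply: filterS (near_cdom hc cx) => q cq /=; rewrite cK.
apply: (@cvg_trans _ (((f \o cinv c) \o cmap c) @ x)).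
  by apply: near_eq_cvg; apply: filterS fE => q /= ->.
have : {for x, continuous ((f \o cinv c) \o cmap c)}.
  apply: continuous_comp; first exact: ccont.
  exact: differentiable_continuous.
by move=> hcont; rewrite -[X in nbhs (f X)](cK x cx); exact: hcont.
Qed.

(** By continuity a representative that does not vanish at [x] has no zero near [x], so its
    pointwise inverse is holomorphic there. This is the locality of the stalk. *)
Lemma germ_on_unit S x (a : germ_on S x) : eval_germ a != 0 ->
  exists a', a' * a = 1.
Proof.
move=> ax0.
have a0 : \forall q \near x, repr a q != 0.
  exact: (cvgr_neq0 (repr a x) (@holofun_continuous x (repr a)) ax0).
have ha : (fun q => (repr a q)^-1) \in @holo_near R n X x.
  apply/asboolP; apply: filterS2 a0 (holofun_near (repr a)) => q aq0 haq.
  move=> c ac cq.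
  have [_ _ cK _ _] := atlas_chart ac.
  by apply: differentiableV; [exact: haq | rewrite /= cK].
exists (\pi_(germ_on S x) (HoloFun ha)).
have h1 := repr_germ1 S x.
have h2 := repr_germM (\pi_(germ_on S x) (HoloFun ha)) a.
have h3 := repr_germ_near S (HoloFun ha).
apply/germ_on_reprP; near=> q => Sq.
rewrite (near h1 q) // (near h2 q) // (near h3 q) //= mulVf //.
by near: q.
Unshelve. all: by end_near. Qed.

End GermQuotient.

(** * Adapted charts: extension of germs from Y, and differentials along Y *)

Lemma coord_linear (K : comPzRingType) n (i : 'I_n) :
  linear (fun z : 'rV[K]_n => z ord0 i : K^o).
Proof. by move=> k u v; rewrite !mxE. Qed.

Lemma diff_coord (K : numFieldType) n (i : 'I_n) (z v : 'rV[K]_n) :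
  'd (fun z : 'rV[K]_n => z ord0 i) z v = v ord0 i.
Proof.
pose fL := GRing.isLinear.Build _ _ _ _ _ (@coord_linear K n i).
pose f : {linear 'rV[K]_n -> K} := HB.pack (fun z : 'rV[K]_n => z ord0 i) fL.
rewrite (_ : (fun z : 'rV[K]_n => z ord0 i) = f) // diff_lin //.
exact: coord_continuous.
Qed.

Section AdaptedChart.
Variables (R : realType) (n : nat) (X : cmanifold R n) (Y : set X) (p : X).
Variables (d : nat) (c : chart R X n).
Hypotheses (cY : adapted_chart Y d c p) (Yp : Y p).
Local Notation C := (Cplx R).
Implicit Types (g h : Ogerm p) (a b : germ_on Y p).

Let hc : holo_chart c. Proof. by case: cY. Qed.
Let ic : is_chart c. Proof. by case: hc. Qed.
Let cp : cdom c p. Proof. by case: cY. Qed.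
Let cK q : cdom c q -> cinv c (cmap c q) = q.
Proof. by case: ic => _ _ + _ _; apply. Qed.
Let YE q : cdom c q ->
  Y q <-> forall i : 'I_n, (i < d)%N -> cmap c q ord0 i = 0.
Proof. by case: cY => _ _ _; apply. Qed.

Let L (z : 'rV[C]_n) : 'rV[C]_n :=
  \row_(i < n) if (i < d)%N then 0 else z ord0 i.

Let chart_projE q : chart_proj d c q = cinv c (L (cmap c q)).
Proof. by []. Qed.

Let differentiableL z : differentiable L z.
Proof.
have -> : L = \sum_(i < n)
    (fun z : 'rV[C]_n => (if (i < d)%N then 0 else z ord0 i) *: 'e_i).
  apply/funext => y; rewrite fct_sumE [LHS]row_sum_delta.
  by apply: eq_bigr => i _; rewrite mxE.
apply: differentiable_sum => i.
apply: differentiableZl; case: (i < d)%N; first exact: differentiable_cst.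
exact: differentiable_coord.
Qed.

Let L_fixed q : cdom c q -> Y q -> L (cmap c q) = cmap c q.
Proof.
move=> cq /YE h; apply/rowP => i; rewrite mxE.
by case: ifP => // id0; rewrite h.
Qed.

Lemma chart_proj_fixed q : cdom c q -> Y q -> chart_proj d c q = q.
Proof. by move=> cq Yq; rewrite chart_projE L_fixed // cK. Qed.

(** [chart_proj] fixes [p] and is continuous there. The last two conjuncts hold only near [p]:
    farther away, [L] may leave the image of the chart, where [cinv] is meaningless. *)
Lemma near_proj_pull (P : X -> Prop) : (\forall q \near p, P q) ->
  \forall q \near p, P (chart_proj d c q) /\
    cmap c (chart_proj d c q) = L (cmap c q) /\ cdom c (chart_proj d c q).
Proof.
move=> Pp.
have [_ _ _ ccont _] := ic.
have near_L : \forall z \near L (cmap c p), P (cinv c z) /\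
    cdom c (cinv c z) /\ cmap c (cinv c z) = z.
  rewrite L_fixed //.
  by apply: filterS2 (near_chart_pull ic cp Pp) (near_chart_inv ic cp).
have Lc : {for cmap c p, continuous L}.
  exact/differentiable_continuous/differentiableL.
have near_cL : \forall z \near cmap c p, P (cinv c (L z)) /\
    cdom c (cinv c (L z)) /\ cmap c (cinv c (L z)) = L z.
  exact: (Lc _ near_L).
have : \forall q \near p, P (cinv c (L (cmap c q))) /\
    cdom c (cinv c (L (cmap c q))) /\ cmap c (cinv c (L (cmap c q))) =
    L (cmap c q) := ccont p cp _ near_cL.
by apply: filterS => q [? []].
Qed.

Lemma holo_near_proj (f : holofun p) :
  (f \o chart_proj d c) \in @holo_near R n X p.
Proof.
apply/asboolP.
(* Differentiability at [q] needs the coordinate formula on a neighborhood of [q], hence the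
   interior. *)
have := nbhs_interior (near_proj_pull (holofun_near f)).
apply: filterS2 (near_cdom ic cp) => q cq nq.
have [fhol [projE cproj]] := nbhs_singleton nq.
apply/(holo_atP _ hc cq).
have df : differentiable ((f \o cinv c) \o L) (cmap c q).
  apply: differentiable_comp; first exact: differentiableL.
  by rewrite -projE; apply/(holo_atP _ hc cproj).
apply: (proj1 (near_eq_diff _ df)).
have := near_chart_pull ic cq nq.
apply: filterS2 (near_chart_inv ic cq) => z [cz zK] [_ [zE _]] /=.
by rewrite /chart_proj zK.
Qed.

(** Holomorphy near [p] rules out the default value of [insubd]. *)
Lemma repr_to_germ_near (f : X -> C) : f \in @holo_near R n X p ->
  \forall q \near p, repr (to_germ p f) q = f q.
Proof.
move=> hf; have := repr_germ_near setT (insubd (0 : holofun p) f).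
apply: filterS => q -> //; last by left.
by rewrite -[holofun_val _]/(val _) insubdK.
Qed.

(** [chart_proj] is the identity on [Y] near [p], so extending a germ does not change its values on
    [Y]. *)
Lemma restr_extend_germ a : restr_germ Y (extend_germ d c a) = a.
Proof.
apply/restr_germ_eqP.
have h1 := repr_to_germ_near (holo_near_proj (repr a)).
have h2 := near_cdom ic cp.
near=> q => Yq; rewrite (near h1 q) //= chart_proj_fixed //; 
  first exact: (near h2).
by case: Yq => [//|->].
Unshelve. all: by end_near. Qed.

(** The Leibniz rule is needed at all points near [p], not only at [p], because membership in I_Y is
    tested along [Y]. *)
Lemma near_diff_germM g h : \forall q \near p, forall v,
  'd (repr (g * h) \o cinv c) (cmap c q) v =
  repr g q * 'd (repr h \o cinv c) (cmap c q) v +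
  repr h q * 'd (repr g \o cinv c) (cmap c q) v.
Proof.
have gh : \forall q \near p, \forall r \near q,
    repr (g * h) r = repr g r * repr h r.
  apply: nbhs_interior; apply: filterS (repr_germM (g : germ_on setT p) h).
  by move=> q; apply; left.
have hg := holofun_near (repr g).
have hh := holofun_near (repr h).
have hcd := near_cdom ic cp.
near=> q => v.
have cq : cdom c q by near: q.
have dg : differentiable (repr g \o cinv c) (cmap c q).
  by apply/(holo_atP _ hc cq); near: q.
have dh : differentiable (repr h \o cinv c) (cmap c q).
  by apply/(holo_atP _ hc cq); near: q.
have ghq : \forall r \near q, repr (g * h) r = repr g r * repr h r.
  by near: q.
have [|_ ghE] := @near_eq_diff _ _ _ _ (repr (g * h) \o cinv c) _ _
    (differentiableM dg dh).
  by apply: filterS (near_chart_pull ic cq ghq) => z /= ->.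
have -> : repr g q = (repr g \o cinv c) (cmap c q) by rewrite /= cK.
have -> : repr h q = (repr h \o cinv c) (cmap c q) by rewrite /= cK.
apply: (etrans (congr1 (@^~ v) ghE)).
exact: (congr1 (@^~ v) (diffM dg dh)).
Unshelve. all: by end_near. Qed.

Lemma near_diff_germD g h : \forall q \near p, forall v,
  'd (repr (g + h) \o cinv c) (cmap c q) v =
  'd (repr g \o cinv c) (cmap c q) v + 'd (repr h \o cinv c) (cmap c q) v.
Proof.
have gh : \forall q \near p, \forall r \near q,
    repr (g + h) r = repr g r + repr h r.
  apply: nbhs_interior; apply: filterS (repr_germD (g : germ_on setT p) h).
  by move=> q; apply; left.
have hg := holofun_near (repr g).
have hh := holofun_near (repr h).
have hcd := near_cdom ic cp.
near=> q => v.
have cq : cdom c q by near: q.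
have dg : differentiable (repr g \o cinv c) (cmap c q).
  by apply/(holo_atP _ hc cq); near: q.
have dh : differentiable (repr h \o cinv c) (cmap c q).
  by apply/(holo_atP _ hc cq); near: q.
have ghq : \forall r \near q, repr (g + h) r = repr g r + repr h r.
  by near: q.
have [|_ ghE] := @near_eq_diff _ _ _ _ (repr (g + h) \o cinv c) _ _
    (differentiableD dg dh).
  by apply: filterS (near_chart_pull ic cq ghq) => z /= ->.
apply: (etrans (congr1 (@^~ v) ghE)).
exact: (congr1 (@^~ v) (diffD dg dh)).
Unshelve. all: by end_near. Qed.

Lemma ideal_germP g :
  ideal_germ Y g <-> \forall q \near p, Y q -> repr g q = 0.
Proof.
rewrite /ideal_germ /= restr_germ_eqP.
(* The representative of 0 need not be the zero function; its vanishing near [p] on [Y] is read off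
   from 0 + 0 = 0. *)
have h0 : \forall q \near p, Y q -> repr (0 : germ_on Y p) q = 0.
  have := repr_germD (0 : germ_on Y p) 0.
  rewrite addr0; apply: filterS => q h Yq.
  have /eqP := h (or_introl Yq).
  by rewrite -subr_eq0 opprD addNKr oppr_eq0 => /eqP.
split=> h; near=> q => Yq.
  by rewrite (near h q) ?(near h0 q) //; left.
have {}Yq : Y q by case: Yq => [//|->].
by rewrite (near h q) ?(near h0 q).
Unshelve. all: by end_near. Qed.

Lemma ideal_germ_powS k g : ideal_germ_pow Y k.+1 g -> ideal_germ Y g.
Proof.
move=> [m [a [b [hab ->]]]]; rewrite /ideal_germ /= rmorph_sum big1 // => i _.
by have [ai _] := hab i; rewrite rmorphM /= [restr_germ _ _]ai mul0r.
Qed.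

(** For a, b in I_Y, the differential a db + b da of the product vanishes wherever a and b do. *)
Lemma diff_ideal_germ_pow2 g : ideal_germ_pow Y 2 g ->
  \forall q \near p, Y q -> forall v,
    'd (repr g \o cinv c) (cmap c q) v = 0.
Proof.
move=> [m [a [b [hab ->]]]].
elim/big_ind: _ => [|g1 g2 h1 h2|i _].
(* The zero germ is treated as the product 0 * 0. *)
- have h00 := near_diff_germM 0 0.
  have h0 : ideal_germ Y (0 : Ogerm p) by rewrite /ideal_germ /= rmorph0.
  move/ideal_germP: h0 => h0.
  rewrite mulr0 in h00; apply: filterS2 h00 h0 => q h00q h0q Yq v.
  apply: (etrans (h00q v)); rewrite (h0q Yq).
  exact: etrans (congr2 +%R (mul0r _) (mul0r _)) (addr0 _).
- apply: filterS3 (near_diff_germD g1 g2) h1 h2 => q hDq h1q h2q Yq v.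
  apply: (etrans (hDq v)).
  by rewrite [X in X + _]h1q // [X in _ + X]h2q // addr0.
- have [/ideal_germP ha hb1] := hab i.
  have /ideal_germP hb := @ideal_germ_powS 0 _ hb1.
  apply: filterS3 (near_diff_germM (a i) (b i)) ha hb => q hMq haq hbq Yq v.
  apply: (etrans (hMq v)).
  rewrite (haq Yq).
  rewrite (hbq Yq).
  exact: etrans (congr2 +%R (mul0r _) (mul0r _)) (addr0 _).
Unshelve. all: by end_near. Qed.

(* A normal coordinate x_1 works: at points of Y the derivative of h x_1
   along x_1 is h, whereas elements of I_Y^2 have zero differential there. *)
Lemma ideal_germ_colon : (0 < d)%N -> exists2 g, ideal_germ Y g &
  forall h, ideal_germ_pow Y 2 (h * g) -> ideal_germ Y h.
Proof.
have [_ _ dn _] := cY; move=> d0.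
pose i0 : 'I_n := Ordinal (leq_trans d0 dn).
pose x1 (q : X) : C := cmap c q ord0 i0.
pose coord (z : 'rV[C]_n) : C := z ord0 i0.
have near_x1 q : cdom c q ->
    \forall z \near cmap c q, coord z = (x1 \o cinv c) z.
  move=> cq; apply: filterS (near_chart_inv ic cq) => z [_ zK].
  by rewrite /x1 /coord /= zK.
have hx1 : x1 \in @holo_near R n X p.
  apply/asboolP; apply: filterS (near_cdom ic cp) => q cq.
  apply/(holo_atP _ hc cq).
  exact: (near_eq_diff (near_x1 q cq) (differentiable_coord _ _ _)).1.
have gE := repr_to_germ_near hx1.
have gE' : \forall q \near p, \forall r \near q,
    x1 r = repr (to_germ p x1) r.
  by apply: nbhs_interior; apply: filterS gE => q ->.
have hcd := near_cdom ic cp.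
exists (to_germ p x1).
  apply/ideal_germP; near=> q => Yq.
  rewrite (near gE q) // /x1; have cq : cdom c q by near: q.
  by move/(YE cq): Yq; apply.
move=> h /diff_ideal_germ_pow2 hh; apply/ideal_germP.
have hM := near_diff_germM h (to_germ p x1).
near=> q => Yq; have cq : cdom c q by near: q.
have hhq : forall v, 'd (repr (h * to_germ p x1) \o cinv c) (cmap c q) v = 0.
  by move=> v; exact: (near hh q).
have x1q : repr (to_germ p x1) q = 0.
  by rewrite (near gE q) // /x1; move/(YE cq): Yq; apply.
have hgE : \forall r \near q, x1 r = repr (to_germ p x1) r by near: q.
have xgE : \forall z \near cmap c q,
    coord z = (repr (to_germ p x1) \o cinv c) z.
  by apply: filterS2 (near_x1 q cq) (near_chart_pull ic cq hgE) => z -> /= ->.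
have dx1 : 'd (repr (to_germ p x1) \o cinv c) (cmap c q) (delta_mx ord0 i0) = 1.
  apply: (etrans
    (congr1 (@^~ _) (near_eq_diff xgE (differentiable_coord _ _ _)).2)).
  by rewrite [LHS]diff_coord mxE !eqxx.
have hMq := near hM q _ (delta_mx ord0 i0); rewrite x1q in hMq.
apply: etrans (etrans (esym (hMq _)) (hhq _)) => //.
exact: esym (etrans
  (congr2 +%R (etrans (congr1 _ dx1) (mulr1 _)) (mul0r _)) (addr0 _)).
Unshelve. all: by end_near. Qed.

End AdaptedChart.

(** * Powers of I_Y and the V-filtration *)

Section VFiltration.
Variables (R : realType) (n : nat) (X : cmanifold R n) (Y : set X) (p : X).
Implicit Types (g h : Ogerm p) (P Q : Dgerm p).

Lemma ideal_germD g h :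
  ideal_germ Y g -> ideal_germ Y h -> ideal_germ Y (g + h).
Proof. by rewrite /ideal_germ /= rmorphD /= => -> ->; rewrite addr0. Qed.

Lemma ideal_germM g h : ideal_germ Y h -> ideal_germ Y (g * h).
Proof. by rewrite /ideal_germ /= rmorphM /= => ->; rewrite mulr0. Qed.

Lemma ideal_germ_powD k g h :
  ideal_germ_pow Y k g -> ideal_germ_pow Y k h -> ideal_germ_pow Y k (g + h).
Proof.
case: k => [//|k] [m1 [a1 [b1 [h1 ->]]]] [m2 [a2 [b2 [h2 ->]]]].
exists (m1 + m2)%N,
  (fun i : 'I_(m1 + m2) =>
    match fintype.split i with inl j => a1 j | inr j => a2 j end),
  (fun i : 'I_(m1 + m2) =>
    match fintype.split i with inl j => b1 j | inr j => b2 j end).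
split=> [i|].
  by case: (fintype.split i) => j; [exact: h1 | exact: h2].
rewrite big_split_ord /=; congr (_ + _); apply: eq_bigr => i _.
  by rewrite (unsplitK (inl i)).
by rewrite (unsplitK (inr i)).
Qed.

Lemma ideal_germ_pow0 k : ideal_germ_pow Y k (0 : Ogerm p).
Proof.
case: k => [//|k]; exists 0, (fun=> 0), (fun=> 0).
by split=> [[]|] //; rewrite big_ord0.
Qed.

Lemma ideal_germ_powM k g h :
  ideal_germ_pow Y k h -> ideal_germ_pow Y k (g * h).
Proof.
case: k => [//|k] [m [a [b [hab ->]]]].
exists m, (fun i => g * a i), b; split=> [i|].
  by have [ai bi] := hab i; split=> //; exact: ideal_germM.
by rewrite mulr_sumr; apply: eq_bigr => i _; rewrite mulrA.
Qed.

Lemma ideal_germ_powMS k g h : ideal_germ Y g -> ideal_germ_pow Y k h ->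
  ideal_germ_pow Y k.+1 (g * h).
Proof.
by move=> Ig hh; exists 1, (fun=> g), (fun=> h); split=> //; rewrite big_ord1.
Qed.

Lemma ideal_germ_zpowD i g h :
  ideal_germ_zpow Y i g -> ideal_germ_zpow Y i h -> ideal_germ_zpow Y i (g + h).
Proof. by case: i => k //=; exact: ideal_germ_powD. Qed.

Lemma ideal_germ_zpowM i g h :
  ideal_germ_zpow Y i h -> ideal_germ_zpow Y i (g * h).
Proof. by case: i => k //=; exact: ideal_germ_powM. Qed.

Lemma VfiltrationD j P Q :
  Vfiltration Y j P -> Vfiltration Y j Q -> Vfiltration Y j (P + Q).
Proof.
by move=> hP hQ i g hg; apply: ideal_germ_zpowD; [exact: hP | exact: hQ].
Qed.

Lemma VfiltrationM j k P Q :
  Vfiltration Y j P -> Vfiltration Y k Q -> Vfiltration Y (j + k) (P * Q).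
Proof.
by move=> hP hQ i g hg; rewrite opprD (addrC (- j)) addrA; apply: hP; exact: hQ.
Qed.

Lemma Vfiltration_dfun g : Vfiltration Y 0 (dfun g).
Proof. by move=> i h hh; rewrite subr0; exact: ideal_germ_zpowM. Qed.

Lemma Vfiltration_dfun_ideal g : ideal_germ Y g -> Vfiltration Y (-1) (dfun g).
Proof.
move=> Ig [k|[|k]] h hh; rewrite opprK.
- by rewrite -PoszD addn1; exact: ideal_germ_powMS.
- by [].
- rewrite (_ : Negz k.+1 + 1 = Negz k) //.
  by rewrite !NegzE -[k.+2]addn1 PoszD opprD subrK.
Qed.

Lemma VfiltrationN j P : Vfiltration Y j P -> Vfiltration Y j (- P).
Proof.
have -> : - P = dfun (- 1) * P by apply/val_inj/funext => g; rewrite /= mulN1r.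
move=> hP; rewrite -[j]add0r; apply: VfiltrationM => //.
exact: Vfiltration_dfun.
Qed.

Lemma Vfiltration_sum j (I : finType) (F : I -> Dgerm p) :
  (forall i, Vfiltration Y j (F i)) -> Vfiltration Y j (\sum_i F i).
Proof.
move=> hF; apply: big_ind => //; last exact: VfiltrationD.
move=> i g _; case: (i - j) => // k; exact: ideal_germ_pow0.
Qed.

Lemma VfiltrationX P k : Vfiltration Y 0 P -> Vfiltration Y 0 (P ^+ k).
Proof.
move=> hP; elim: k => [|k IH]; first exact: Vfiltration_dfun.
by rewrite exprS -[0]addr0; exact: VfiltrationM.
Qed.

Lemma dfun0 : dfun (0 : Ogerm p) = 0.
Proof. by apply/val_inj/funext => f; rewrite /= mul0r. Qed.

Lemma dfunD g h : dfun (g + h) = dfun g + dfun h.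
Proof. by apply/val_inj/funext => f; rewrite /= mulrDl. Qed.

Lemma dfunN g : dfun (- g) = - dfun g.
Proof. by apply/val_inj/funext => f; rewrite /= mulNr. Qed.

Lemma dfunM g h : dfun (g * h) = dfun g * dfun h.
Proof. by apply/val_inj/funext => f; rewrite /= mulrA. Qed.

End VFiltration.

(** * The stalk of J_Y(u) is an ideal *)

Section IndicialIdeal.
Variables (R : realType) (n : nat) (X : cmanifold R n) (Y : set X) (p : X).
Variables (M : Dmodule X) (u : forall x, M x).
Variables (d : nat) (c : chart R X n) (theta : Dgerm p).
Hypotheses (cY : adapted_chart Y d c p) (Yp : Y p).
Hypothesis thetaE : euler_field Y d theta.
Implicit Types (g h : Ogerm p) (a b : germ_on Y p) (f : {poly germ_on Y p}).

Let theta_der g h : theta (g * h) = theta g * h + g * theta h.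
Proof. by case: thetaE => -[]. Qed.

(** [theta] maps I_Y to itself, since theta g - g lies in I_Y^2; the Leibniz rule extends this to
    all powers by induction. *)
Lemma Vfiltration_euler : Vfiltration Y 0 theta.
Proof.
case=> k g; rewrite subr0 //=; elim: k g => [//|k IH] _ [m [a [b [hab ->]]]].
have thetaI h : ideal_germ Y h -> ideal_germ Y (theta h).
  move=> Ih; rewrite -[theta h](subrK h); apply: ideal_germD => //.
  by apply: (@ideal_germ_powS R n X Y p 1); case: thetaE => _ + _; apply.
elim/big_ind: _ => [|g h hg hh|i _].
- have -> : theta 0 = 0.
    by apply: (addrI (theta 0)); rewrite -dop_additive !addr0.
  exact: ideal_germ_pow0.
- by rewrite dop_additive; exact: ideal_germ_powD.
- have [Ia hb] := hab i; rewrite theta_der; apply: ideal_germ_powD.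
    by apply: ideal_germ_powMS => //; exact: thetaI.
  by apply: ideal_germ_powMS => //; exact: IH.
Qed.

(* For g in I_Y, theta(h) g is congruent to theta(h g) - h g, hence to 0,
   modulo I_Y^2. *)
Lemma euler_ideal_germ h : ideal_germ Y (theta h).
Proof.
have [_ hI2 htheta0] := thetaE.
have [d0|d0] := posnP d.
  by rewrite (htheta0 d0); exact: (rmorph0 (@restr_germ R n X Y p)).
have [g Ig] := ideal_germ_colon cY Yp d0; apply.
have -> : theta h * g = theta (h * g) - h * g + - h * (theta g - g).
  by rewrite theta_der mulNr mulrBr opprB addrA subrK addrK.
apply: ideal_germ_powD; first exact/hI2/ideal_germM.
exact/ideal_germ_powM/hI2.
Qed.

(** The Leibniz rule read as a commutator; by [euler_ideal_germ] the last term lies in V^-1. *)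
Lemma euler_dfun h : theta * dfun h = dfun h * theta + dfun (theta h).
Proof. by apply/val_inj/funext => g; rewrite /= theta_der addrC. Qed.

(** Two lifts of a coefficient differ by an element of I_Y, and I_Y theta^k lies in V^-1. Hence
    f(theta) may be computed modulo V^-1 with any lifts and any sufficiently long range. *)
Lemma subst_field_congr f N (h : nat -> Ogerm p) : (size f <= N)%N ->
  (forall k, restr_germ Y (h k) = f`_k) ->
  Vfiltration Y (-1) (subst_field d c theta f -
                      \sum_(k < N) dfun (h k) * theta ^+ k).
Proof.
move=> fN hf.
(* Padding by 0 past [size f] avoids comparing the extension of a zero coefficient with 0. *)
pose e k := if (k < size f)%N then extend_germ d c f`_k else 0.
have he k : restr_germ Y (e k) = f`_k.
  rewrite /e; case: ltnP => fk; first exact: restr_extend_germ cY Yp _.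
  by rewrite rmorph0 nth_default.
have -> : subst_field d c theta f = \sum_(k < N) dfun (e k) * theta ^+ k.
  rewrite /subst_field (big_ord_widen _
    (fun k => dfun (extend_germ d c f`_k) * theta ^+ k) fN).
  rewrite big_mkcond; apply: eq_bigr => k _; rewrite /e; case: ifP => // _.
  by rewrite dfun0 mul0r.
rewrite -sumrB; apply: Vfiltration_sum => k.
rewrite -mulrBl -dfunN -dfunD -[-1]addr0; apply: VfiltrationM.
  apply: Vfiltration_dfun_ideal.
  by rewrite /ideal_germ /= rmorphB /= he hf subrr.
exact/VfiltrationX/Vfiltration_euler.
Qed.

(** [indicial_ideal] is [W] applied to f(theta). Working with operators allows corrections in V^-1
    and left multiplication by V^0. *)
Let W (Q : Dgerm p) := exists2 P, Vfiltration Y (-1) P & Q *: u p = P *: u p.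

Let WD Q Q' : W Q -> W Q' -> W (Q + Q').
Proof.
move=> [P hP e] [P' hP' e']; exists (P + P'); first exact: VfiltrationD.
by rewrite !scalerDl e e'.
Qed.

Let WM Q Q' : Vfiltration Y 0 Q -> W Q' -> W (Q * Q').
Proof.
move=> hQ [P hP e]; exists (Q * P); last by rewrite -!scalerA e.
by rewrite -[-1]add0r; exact: VfiltrationM.
Qed.

Let W_congr Q Q' : Vfiltration Y (-1) (Q' - Q) -> W Q -> W Q'.
Proof.
by move=> h hQ; rewrite -(subrK Q Q'); apply: WD => //; exists (Q' - Q).
Qed.

Local Notation J := (indicial_ideal d c theta u).

(** Sums of lifts lift the sums of coefficients, so [subst_field_congr] absorbs both the choice of
    lifts and a possible drop in degree. *)
Lemma indicial_idealD f f' : J f -> J f' -> J (f + f').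
Proof.
(* [T] gives [f] and [f'] a common range of summation, at the cost of an operator in V^-1. *)
pose T (h : {poly germ_on Y p}) :=
  \sum_(k < maxn (size f) (size f')) dfun (extend_germ d c h`_k) * theta ^+ k.
have TE f0 : (size f0 <= maxn (size f) (size f'))%N ->
    Vfiltration Y (-1) (subst_field d c theta f0 - T f0).
  move=> hN.
  apply: (subst_field_congr (h := fun k => extend_germ d c f0`_k)) => //.
  by move=> k; exact: restr_extend_germ.
move=> Jf Jf'.
have WT f0 : (size f0 <= maxn (size f) (size f'))%N -> J f0 -> W (T f0).
  by move=> /TE /VfiltrationN; rewrite opprB; exact: W_congr.
apply: (W_congr (Q := T f + T f')); last first.
  by apply: WD; apply: WT => //; [exact: leq_maxl | exact: leq_maxr].
have -> : T f + T f' = \sum_(k < maxn (size f) (size f'))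
    dfun (extend_germ d c f`_k + extend_germ d c f'`_k) * theta ^+ k.
  by rewrite -big_split; apply: eq_bigr => k _; rewrite dfunD mulrDl.
apply: (subst_field_congr
  (h := fun k => extend_germ d c f`_k + extend_germ d c f'`_k)).
  exact: size_polyD.
by move=> k; rewrite rmorphD /= !(restr_extend_germ cY Yp) coefD.
Qed.

Lemma indicial_idealC a f : J f -> J (a%:P * f).
Proof.
move=> Jf; apply: W_congr (WM (Vfiltration_dfun (extend_germ d c a)) Jf).
have -> : dfun (extend_germ d c a) * subst_field d c theta f =
    \sum_(k < size f)
      dfun (extend_germ d c a * extend_germ d c f`_k) * theta ^+ k.
  by rewrite mulr_sumr; apply: eq_bigr => k _; rewrite dfunM mulrA.
apply: (subst_field_congr
  (h := fun k => extend_germ d c a * extend_germ d c f`_k)).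
  by rewrite mul_polyC size_scale_leq.
by move=> k; rewrite rmorphM /= !(restr_extend_germ cY Yp) coefCM.
Qed.

(** Left multiplication by [theta] preserves [W], but coefficients must stand to the left of
    [theta]; moving [theta] across them costs only terms of V^-1. *)
Lemma indicial_idealX f : J f -> J ('X * f).
Proof.
move=> Jf; apply: W_congr (WM Vfiltration_euler Jf).
have thetaS : Vfiltration Y (-1)
    (theta * subst_field d c theta f - subst_field d c theta f * theta).
  rewrite mulr_sumr mulr_suml -sumrB; apply: Vfiltration_sum => k.
  rewrite mulrA euler_dfun mulrDl -!mulrA -exprS -exprSr addrC addKr.
  rewrite -[-1]addr0; apply: VfiltrationM.
    exact/Vfiltration_dfun_ideal/euler_ideal_germ.
  exact/VfiltrationX/Vfiltration_euler.
(* The difference between (s f)(theta) and theta f(theta) is split at f(theta) theta. *)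
rewrite -[_ - _](subrKA (subst_field d c theta f * theta)).
apply: VfiltrationD; last by rewrite -opprB; exact: VfiltrationN.
(* These lift the coefficients of ['X * f], shifted by one from those of [f]. *)
pose h k := if k is k'.+1 then extend_germ d c f`_k' else 0.
have -> : subst_field d c theta f * theta =
    \sum_(k < (size f).+1) dfun (h k) * theta ^+ k.
  rewrite big_ord_recl /= expr0 mulr1.
  rewrite dfun0 add0r mulr_suml; apply: eq_bigr => k _.
  by rewrite -mulrA -exprSr.
apply: (subst_field_congr (h := h)).
  by rewrite mulrC (leq_trans (size_polyMleq _ _)) // size_polyX addn2.
case=> [|k] /=; rewrite coefXM //=; first exact: rmorph0.
exact: restr_extend_germ.
Qed.

Lemma indicial_idealM q f : J f -> J (q * f).
Proof.
move=> Jf; elim/poly_ind: q => [|q a IH].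
  by rewrite -[0]polyC0; exact: indicial_idealC.
rewrite mulrDl; apply: indicial_idealD; last exact: indicial_idealC.
by rewrite mulrAC mulrC; exact: indicial_idealX.
Qed.

End IndicialIdeal.

(** * Divisibility, uniqueness and common zeros at p *)

Theorem proposition1 (R : realType) (n : nat) (X : cmanifold R n)
    (Y : set X) (M : Dmodule X) (p : X) (U : set X) (u : forall x, M x)
    (d : nat) (c : chart R X n) (theta : Dgerm p) (b : {poly germ_on Y p}) :
  submanifold Y -> coherent M -> Y p ->
  open U -> U p -> msection U u ->
  adapted_chart Y d c p -> euler_field Y d theta ->
  indicial_polynomial d c theta u b ->
  [/\ forall b' : {poly germ_on Y p},
        indicial_polynomial d c theta u b' -> poly_at b' = poly_at b,
      forall f : {poly germ_on Y p},
        indicial_ideal d c theta u f -> poly_at b %| poly_at f &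
      [set s : Cplx R | forall f : {poly germ_on Y p},
         indicial_ideal d c theta u f -> (poly_at f).[s] = 0]
      = [set s : Cplx R | (poly_at b).[s] = 0]].
Proof.
move=> _ _ Yp _ _ _ cY thetaE bind.
(* Stated for every indicial polynomial [b1], so that uniqueness follows by exchanging [b] and
   [b']. *)
have dvd (b1 f : {poly germ_on Y p}) :
    indicial_polynomial d c theta u b1 -> indicial_ideal d c theta u f ->
    poly_at b1 %| poly_at f.
  move=> [Jb1 b1m b1min].
  apply: (dvdp_map_minimal_monic (@germ_on_unit R n X Y p) _ _
    Jb1 b1m b1min).
    by move=> f1 f2; exact: (indicial_idealD cY Yp thetaE).
  by move=> q f1; exact: (indicial_idealM cY Yp thetaE).
have [Jb bm _] := bind.
split=> [b' b'ind|f Jf|].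
- have [Jb' b'm _] := b'ind.
  (* Two monic polynomials dividing each other are equal. *)
  have eqp_b : poly_at b' %= poly_at b by rewrite /eqp !dvd.
  exact: eqP (etrans
    (esym (eqp_monic (monic_map _ b'm) (monic_map _ bm))) eqp_b).
- exact: dvd bind Jf.
(* One inclusion takes [f] to be [b]; the other follows from divisibility. *)
- apply/seteqP; split=> [s|s bs f Jf]; first exact.
  have /dvdpP [q ->] := dvd b f bind Jf.
  exact: etrans (hornerM _ _ _) (etrans (congr1 _ bs) (mulr0 _)).
Qed.
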